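(* For a chart group $G$ the following conditions are equivalent: (i) $G$ is a topological group; (ii) every Schur ultrafilter on $G$ converges to $1_G$; (iii) there exists a dense subgroup $H$ of $G$ with $H\subseteq\Lambda(G)$ such that each Schur ultrafilter on $H$ converges to $1_G$.
   Context: A right topological group is a group $G$ with a topology such that for each $s\in G$ the right shift $x\mapsto xs$ is continuous. $\Lambda(G)=\{s\in G:\text{the left shift }x\mapsto sx\text{ is continuous}\}$. A chart group is a compact Hausdorff right topological group $G$ such that $\Lambda(G)$ is dense in $G$. A topological group is a group with a topology in which multiplication and inversion are continuous. An ultrafilter $u$ on (the underlying set of) a group is Schur if for each $U\in u$ there exist $x,y\in U$ such that $xy\in U$. An ultrafilter $u$ on a subgroup $H$ of $G$ converges to $1_G$ if $V\cap H\in u$ for every open neighborhood $V\subseteq G$ of $1_G$. *)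

(* Defs.v *)
From HB Require Import structures.
From mathcomp Require Import all_boot.
From mathcomp Require Import all_classical topology.

Set Implicit Arguments.
Unset Strict Implicit.
Unset Printing Implicit Defensive.

Local Open Scope classical_set_scope.
Local Open Scope group_scope.

(* No compatibility between the group law and the topology is assumed here. *)
#[short(type="groupTopologicalType")]
HB.structure Definition GroupTopological := {G of Group G & Topological G}.

Definition right_topological (G : groupTopologicalType) : Prop :=
  forall s : G, continuous (fun x : G => x * s).

Definition Lambda (G : groupTopologicalType) : set G :=
  [set s : G | continuous (fun x : G => s * x)].
Arguments Lambda : clear implicits.

Definition chart_group (G : groupTopologicalType) : Prop :=
  [/\ compact [set: G], hausdorff_space G, right_topological G
    & dense (Lambda G)].

Definition topological_group (G : groupTopologicalType) : Prop :=
  continuous (fun p : G * G => p.1 * p.2) /\ continuous (fun x : G => x^-1).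

Definition schur (G : groupType) (u : set_system G) : Prop :=
  forall U : set G, u U -> exists x y : G, [/\ U x, U y & U (x * y)].

Record subgroup (G : groupType) := Subgroup {
  subgroup_set :> set G;
  subgroup_closed : group_closed (mem subgroup_set)
}.

HB.instance Definition _ (G : groupType) (H : subgroup G) :=
  SubChoice.copy (set_type H) {x : G | x \in subgroup_set H}.

HB.instance Definition _ (G : groupType) (H : subgroup G) :=
  SubChoice_isSubGroup.Build G _ (set_type H) (subgroup_closed H).

(* [set_val @^-1` V] is [V] intersected with [H], as a subset of the type [H]. *)
Definition subgroup_cvg1 (G : groupTopologicalType) (H : subgroup G)
    (u : set_system H) : Prop :=
  forall V : set G, open V -> V 1 -> u (set_val @^-1` V).

(* Main.v *)
Require Import Defs.
From HB Require Import structures.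
From mathcomp Require Import all_boot all_order all_algebra lra.
From mathcomp Require Import all_classical all_reals topology normedtype Rstruct.

(** Three ideas carry the theorem.

    In a topological group, products of elements near [p] are near [p * p]; if
    a Schur ultrafilter converges to [p], some of these products are also near
    [p], so [p * p = p] and [p = 1] ([schur_cvg1]); this gives (ii).  For (iii) one may
    then take [H = Lambda G]: an invertible continuous self-map of a compact
    Hausdorff space is a homeomorphism, so [Lambda G] is a group
    ([Lambda_group_closed]), and Schur ultrafilters push forward along the
    inclusion.

    For the way back from (iii), the point is that quotients produce Schur
    triples: [(x^-1 * y) * (y^-1 * z) = x^-1 * z].  Hence for every ultrafilter
    [p] on [H] the sets containing [x^-1 * y] for [p]-most [x] and, given [x],
    for [p]-most [y], form a Schur ultrafilter ([ratio_filter_schur]).  If [p]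
    converges to [g] in [G], then letting [y] tend to [g] is legitimate because
    [x^-1] is in [Lambda G], so (iii) says that [x^-1 * g] tends to [1], that
    is, [x^-1] tends to [g^-1] ([ratio_cvg_invg]).  As [H] is dense and [G] is
    regular, inversion is continuous on all of [G]
    ([schur_cvg_continuous_invg]), and it turns right shifts into left shifts.

    It remains to pass from separate to joint continuity of the product, which
    is the theorem of Ellis.  For a separately continuous real function [f] on
    a product of compact spaces, some point [x0] is a point of equicontinuity,
    up to a given [e], of the family of all [f _ y]
    ([separately_continuous_equicontinuity_point], a quantitative form of a
    theorem of Namioka).  For [f x y = h (x * y)] the translation identity
    [(x * s) * y = x * (s * y)] moves [x0] to any prescribed point, and
    functions [h] separating a point from a closed set then give joint
    continuity ([separately_continuous_mulg]). *)

Import Order.TTheory GRing.Theory Num.Theory numFieldNormedType.Exports.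

Set Implicit Arguments.
Unset Strict Implicit.
Unset Printing Implicit Defensive.

Local Open Scope classical_set_scope.

(** * Ultrafilters *)

Lemma ultra_setVsetC (T : Type) (F : set_system T) : ProperFilter F ->
  (forall A, F A \/ F (~` A)) -> UltraFilter F.
Proof.
move=> FF dec; split=> // G GF FG; apply/seteqP; split => // A GA.
have [//|/FG GnA] := dec A.
by have [? []] := filter_ex (filterI GA GnA).
Qed.

Lemma ultra_fmap (T T' : Type) (g : T -> T') (F : set_system T) :
  UltraFilter F -> UltraFilter (g @ F).
Proof.
by move=> FU; apply: ultra_setVsetC => A; exact: (in_ultra_setVsetC (g @^-1` A)).
Qed.

Lemma compact_ultra_cvg (T : Type) (X : topologicalType) (u : T -> X)
    (F : set_system T) :
  UltraFilter F -> compact [set: X] -> exists l : X, u x @[x --> F] --> l.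
Proof.
move=> FU; rewrite compact_ultra => /(_ _ (ultra_fmap u FU) filterT).
by case=> l [_ ?]; exists l.
Qed.

(** * Equicontinuity points of separately continuous functions *)

Section Namioka.
Local Open Scope ring_scope.
Context {R : realType} {X Y : topologicalType} (f : X -> Y -> R).
Context (f_contl : forall y, continuous (f^~ y)).
Context (f_contr : forall x, continuous (f x)).

Definition spread (d e : R) (F : seq X) (x : X) (y y' : Y) : Prop :=
  {in F, forall i, `|f i y - f i y'| < d} /\ e < `|f x y - f x y'|.

Lemma near_agree (d : R) (F : seq X) (y0 : Y) : 0 < d ->
  \forall y \near y0, {in F, forall i, `|f i y - f i y0| < d}.
Proof.
move=> d0; elim: F => [|i F IH]; first by apply: nearW.
have iy : \forall y \near y0, `|f i y - f i y0| < d.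
  have /cvgrPdist_lt/(_ d d0) := f_contr (x := i) (x0 := y0).
  by apply: filterS => y; rewrite distrC.
apply: filterS2 iy IH => y iy Fy j; rewrite inE => /predU1P[->//|]; exact: Fy.
Qed.

(** If no [x] in [O] tells apart two points that agree on [F], then a
    comparison of [f x] with [f x0] at the single point [y0] bounds their
    difference at all [y] agreeing with [y0] on [F].  Such [y] form a
    neighbourhood of [y0], and compactness of [Y] makes the bound uniform. *)
Lemma no_spread_equicontinuous (d e : R) (F : seq X) (x0 : X) (O : set X) :
  compact [set: Y] -> 0 < d -> 0 < e -> nbhs x0 O ->
  (forall x y y', O x -> ~ spread d e F x y y') ->
  \forall x \near x0, forall y, `|f x y - f x0 y| <= 3 * e.
Proof.
move=> /compact_near_coveringP cY d0 e0 Ox0 noO.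
have close x y y' : O x -> {in F, forall i, `|f i y - f i y'| < d} ->
    `|f x y - f x y'| <= e.
  by move=> Ox yy'; rewrite leNgt; apply/negP => ?; apply: (noO x y y').
suff : \forall x \near x0, [set: Y] `<=` [set y | `|f x y - f x0 y| <= 3 * e].
  by apply: filterS => x + y; apply.
apply: cY => y0 _.
have xO : \forall x \near x0, O x /\ `|f x y0 - f x0 y0| < e.
  apply: filterI => //.
  have /cvgrPdist_lt/(_ e e0) := f_contl (y := y0) (x := x0).
  by apply: filterS => y; rewrite distrC.
exists ([set y | {in F, forall i, `|f i y - f i y0| < d}],
        [set x | O x /\ `|f x y0 - f x0 y0| < e]).
  by split => //; exact: near_agree.
move=> [y x] [/= Fy [Ox xx0]].
have := close x y y0 Ox Fy; have := close x0 y y0 (nbhs_singleton Ox0) Fy.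
move: xx0; rewrite ltr_norml !ler_norml; lra.
Qed.

(** If no point were an equicontinuity point up to [e], one could choose
    shrinking open sets [U n], points [x_ n] in [U n.+1] and pairs
    [y n, y' n] that agree up to [eta / 2] on [x_ 0, ..., x_ n.-1] and yet are
    separated by more than [eta] by every point of [U n.+1].  Let [x1], [y1],
    [y1'] be limits of these sequences along one ultrafilter.  Then [y1] and
    [y1'] agree up to [eta / 2] on every [x_ i], hence on [x1]; but [x1] lies
    in all the [U n], so it separates them by at least [eta]. *)
Lemma separately_continuous_equicontinuity_point (e : R) (x : X) :
  hausdorff_space X -> compact [set: X] -> compact [set: Y] -> 0 < e ->
  exists x0, \forall x \near x0, forall y, `|f x y - f x0 y| <= e.
Proof.
move=> hX cX cY e0; apply: contrapT => noeq.
(* The factor 3 is the one lost in [no_spread_equicontinuous]. *)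
pose eta := e / 3; have eta0 : 0 < eta by rewrite /eta; lra.
have step (F : seq X) (O : set X) : open O -> O !=set0 ->
    exists (O' : set X) (p : Y * Y), [/\ open O', O' !=set0, closure O' `<=` O
      & forall z, O' z -> spread (eta / 2) eta F z p.1 p.2].
  move=> oO [x0 Ox0]; have nO : nbhs x0 O by exact: open_nbhs_nbhs.
  have [a [y [y' [Oa sa]]]] : exists a y y', O a /\ spread (eta / 2) eta F a y y'.
    apply: contrapT => no; apply: noeq; exists x0.
    have -> : e = 3 * eta by rewrite /eta; lra.
    apply: (@no_spread_equicontinuous (eta / 2) eta F x0 O) => //.
      by rewrite /eta; lra.
    by move=> a y y' Oa sa; apply: no; exists a, y, y'.
  have [Fyy' eyy'] := sa.
  have na : nbhs a (O `&` [set z | eta < `|f z y - f z y'|]).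
    apply: filterI; first exact: open_nbhs_nbhs.
    have : `|f z y - f z y'| @[z --> a] --> `|f a y - f a y'|.
      by apply: cvg_norm; apply: cvgB; exact: f_contl.
    by move/cvgr_gt; apply.
  have [B Ba BO] := compact_regular hX cX filterT na.
  exists B°, (y, y'); split.
  - exact: open_interior.
  - by exists a.
  - by move=> z /(closureS (@interior_subset _ B))/BO[].
  - by move=> z /interior_subset/subset_closure/BO[].
(* A state of the construction: the points chosen so far, the current open set,
   and the pair chosen at the last step. *)
pose good (U : set X) := open U /\ U !=set0.
pose St := (seq X * {U : set X | good U} * (Y * Y))%type.
pose next (s s' : St) := let: (F, U, _) := s in let: (F', U', p') := s' in
  [/\ exists2 z, sval U' z & F' = z :: F, closure (sval U') `<=` sval U
    & forall z, sval U' z -> spread (eta / 2) eta F z p'.1 p'.2].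
have nextE s : {s' | next s s'}.
  apply: cid; case: s => [[F [U [oU U0]]] p].
  have [U' [p' [oU' U'0 cU' sU']]] := step F U oU U0; have [z Uz] := U'0.
  by exists (z :: F, exist _ U' (conj oU' U'0), p'); split => //; exists z.
have [_ [p0 _]] := step [::] setT openT (ex_intro _ x I).
have gT : good setT by split; [exact: openT|exists x].
have [st [_ st_next]] := dependent_choice nextE ([::], exist _ setT gT, p0).
pose U n := sval (st n).1.2; pose F n := (st n).1.1.
pose y n := (st n.+1).2.1; pose y' n := (st n.+1).2.2.
have /choice[x_ x_P] n : exists z, U n.+1 z /\ F n.+1 = z :: F n.
  have := st_next n; rewrite /U /F; case: (st n) (st n.+1) => [[? ?] ?] [[? ?] ?].
  by move=> [[z ? ->] _ _]; exists z.
have clU n : closure (U n.+1) `<=` U n.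
  have := st_next n; rewrite /U /F.
  by case: (st n) (st n.+1) => [[? ?] ?] [[? ?] ?] [].
have spreadU n z : U n.+1 z -> spread (eta / 2) eta (F n) z (y n) (y' n).
  have := st_next n; rewrite /U /F /y /y'.
  by case: (st n) (st n.+1) => [[? ?] ?] [[? ?] ?] [_ _]; apply.
have xF i n : (i < n)%N -> x_ i \in F n.
  elim: n => // n IH; rewrite ltnS leq_eqVlt (x_P n).2 inE => /predU1P[->|/IH->].
    by rewrite eqxx.
  by rewrite orbT.
have xU n m : (n <= m)%N -> U n (x_ m).
  have decr k : U (n + k)%N `<=` U n.
    elim: k => [|k IH]; first by rewrite addn0.
    by rewrite addnS => z /subset_closure/clU/IH.
  move=> nm; apply: (decr (m - n).+1).
  by rewrite addnS subnKC //; exact: (x_P m).1.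
have [W [W_ultra ooW]] := ultraFilterLemma eventually_filter.
have W_proper : ProperFilter W by exact: ultra_proper.
have [x1 x_x1] := compact_ultra_cvg x_ W_ultra cX.
have [y1 y_y1] := compact_ultra_cvg y W_ultra cY.
have [y1' y_y1'] := compact_ultra_cvg y' W_ultra cY.
have fyy' z : `|f z (y n) - f z (y' n)| @[n --> W] --> `|f z y1 - f z y1'|.
  apply: cvg_norm; apply: cvgB.
    by apply: cvg_comp y_y1 _; exact: f_contr.
  by apply: cvg_comp y_y1' _; exact: f_contr.
have fxx1 : `|f (x_ n) y1 - f (x_ n) y1'| @[n --> W] --> `|f x1 y1 - f x1 y1'|.
  apply: cvg_norm; apply: cvgB.
    exact: (cvg_comp x_ (f^~ y1) x_x1 (@f_contl y1 x1)).
  exact: (cvg_comp x_ (f^~ y1') x_x1 (@f_contl y1' x1)).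
have le_lim (g : nat -> R) (l c : R) : g n @[n --> W] --> l ->
    (\forall n \near W, g n <= c) -> l <= c.
  by move=> gl gc; exact: (closed_cvg (fun r => r <= c) (@closed_le _ c) gc l gl).
have ge_lim (g : nat -> R) (l c : R) : g n @[n --> W] --> l ->
    (\forall n \near W, c <= g n) -> c <= l.
  by move=> gl gc; exact: (closed_cvg (fun r => c <= r) (@closed_ge _ c) gc l gl).
have small : `|f x1 y1 - f x1 y1'| <= eta / 2.
  apply: (le_lim _ _ _ fxx1); apply: nearW => i.
  apply: (le_lim _ _ _ (fyy' (x_ i))).
  apply: ooW; exists i.+1 => // n /= ni.
  by rewrite ltW//; apply: (spreadU n _ (x_P n).1).1; exact: xF.
have Ux1 n : U n x1.
  apply: clU; apply: (closed_cvg (closure (U n.+1)) _ _ x1 x_x1).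
    exact: closed_closure.
  by apply: ooW; exists n.+1 => // m /= nm; apply: subset_closure; exact: xU.
have big : eta <= `|f x1 y1 - f x1 y1'|.
  apply: (ge_lim _ _ _ (fyy' x1)).
  by apply: nearW => n; rewrite ltW//; exact: (spreadU n _ (Ux1 n.+1)).2.
lra.
Qed.
End Namioka.

Local Open Scope group_scope.

(** * Joint continuity of the product *)

(** The equicontinuity point [a] of [fun x y => f (x * y)] moves to [x0] along
    the right shift by [s = a^-1 * x0], as [x * y = (x * s^-1) * (s * y)]. *)
Lemma separately_continuous_mulg (G : groupTopologicalType) :
  compact [set: G] -> hausdorff_space G -> right_topological G ->
  (forall s : G, continuous (fun x => s * x)) ->
  continuous (fun p : G * G => p.1 * p.2).
Proof.
move=> cG hG rG lG [x0 y0] V /= nV; pose R : realType := Rdefinitions.R.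
have /(_ (x0 * y0) (~` V°)) sep : completely_regular_space G.
  apply: normal_completely_regular; first exact: Rdefinitions.R.
    exact: compact_normal.
  exact: hausdorff_accessible.
have /(uniform_separatorP (R:=R)) [f [cf _ f0 f1]] :
    uniform_separator [set x0 * y0] (~` V°).
  apply: sep; first exact/open_closedC/open_interior.
  by move=> /(_ nV).
have {}f0 : f (x0 * y0) = 0%R by apply: f0; exists (x0 * y0).
have fV z : (f z < 1)%R -> V z.
  move=> fz; apply: contrapT => nVz; move: fz.
  have -> : f z = 1%R by apply: f1; exists z => // /interior_subset.
  by rewrite ltxx.
pose F (x y : G) := f (x * y).
have Fl y : continuous (F^~ y).
  by move=> x; apply: (cvg_comp (fun x => x * y) f (rG y x)); exact: cf.
have Fr x : continuous (F x).
  by move=> y; apply: (cvg_comp (fun y => x * y) f (lG x y)); exact: cf.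
have e0 : (0 < 1 / 4 :> R)%R by lra.
have [a na] := separately_continuous_equicontinuity_point Fl Fr x0 hG cG cG e0.
pose s := a^-1 * x0.
have x0s : x0 * s^-1 = a by rewrite /s invgM invgK mulVKg.
have nx : \forall x \near x0, forall y, (`|F (x * s^-1)%g y - F a y| <= 1 / 4)%R.
  have rs : x * s^-1 @[x --> x0] --> a by rewrite -x0s; exact: rG.
  exact: (rs _ na).
have ny : \forall y \near y0, (`|F x0 y| < 1 / 4)%R.
  have := Fr x0 y0 => /cvgrPdist_lt/(_ _ e0).
  by apply: filterS => y; rewrite {1}/F f0 sub0r normrN.
exists ([set x | forall y, (`|F (x * s^-1)%g y - F a y| <= 1 / 4)%R],
        [set y | (`|F x0 y| < 1 / 4)%R]) => //= -[x y] [/= /(_ (s * y))].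
rewrite /F mulgA mulgVK [a * _]mulgA mulVKg => xy yy; apply: fV.
by move: xy yy; rewrite ler_norml ltr_norml; lra.
Qed.

(** * Schur ultrafilters of quotients *)

(** The product, in the Stone-Cech semigroup of the discrete group [K], of the
    inverse of [p] with [p]. *)
Definition ratio_filter (K : groupType) (p : set_system K) : set_system K :=
  [set A | \forall x \near p, \forall y \near p, A (x^-1 * y)].

Lemma ratio_filter_ultra (K : groupType) (p : set_system K) :
  UltraFilter p -> UltraFilter (ratio_filter p).
Proof.
move=> pU; have pP : ProperFilter p by exact: ultra_proper.
have qP : ProperFilter (ratio_filter p).
  apply: Build_ProperFilter_ex.
    move=> A pA; have [x pxA] := @filter_ex _ p _ _ pA.
    by have [y ?] := filter_ex pxA; exists (x^-1 * y).
  split.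
  - by apply: (@nearW _ p) => x; apply: (@nearW _ p).
  - by move=> A B; apply: (@filterS2 _ p) => x; apply: filterS2.
  - by move=> A B AB; apply: (@filterS _ p) => x; apply: filterS => y /AB.
apply: ultra_setVsetC => A.
have [pA|pnA] := in_ultra_setVsetC [set x | \forall y \near p, A (x^-1 * y)] pU.
  by left.
right; apply: (@filterS _ p) pnA => x /= nA.
by have [/nA|] := in_ultra_setVsetC [set y | A (x^-1 * y)] pU.
Qed.

(** Given [U] in the filter, choose [x], then [y], then [z], each generic for
    [p] given the previous ones: the three quotients [x^-1 * y], [y^-1 * z] and
    [x^-1 * z] all lie in [U], and the last one is the product of the others. *)
Lemma ratio_filter_schur (K : groupType) (p : set_system K) :
  ProperFilter p -> schur (ratio_filter p).
Proof.
move=> pP U pU.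
have [x xU] := @filter_ex _ p _ _ pU.
have [y [yU xyU]] := @filter_ex _ p _ _ (@filterI _ p _ _ _ pU xU).
have [z [zU xzU]] := filter_ex (filterI yU xU).
exists (x^-1 * y), (y^-1 * z); split => //.
by rewrite mulgA mulgK.
Qed.

(** Letting [y] tend to [g] in [x^-1 * y], which is near [1] for [p]-most [x]
    and [y], gives that [x^-1 * g] is near [1]; shift by [g^-1] on the right. *)
Lemma ratio_cvg_invg (G : groupTopologicalType) (H : subgroup G)
    (p : set_system H) (g : G) :
  regular_space G -> right_topological G ->
  H `<=` Lambda G -> ProperFilter p ->
  subgroup_cvg1 (ratio_filter p) -> (set_val : H -> G) @ p --> g ->
  (fun h : H => (set_val h)^-1) @ p --> g^-1.
Proof.
move=> regG rG HL pP p1 pg W nW /=.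
have nW1 : nbhs 1 [set z | W (z * g^-1)].
  have r1 : z * g^-1 @[z --> 1] --> g^-1 by rewrite -[X in _ --> X]mul1g; exact: rG.
  exact: (r1 _ nW).
have [B nB BW] := regG _ _ nW1.
have pB := p1 _ (open_interior B) nB.
apply: (@filterS _ p _ _ _ _ pB) => x /= xB.
have /= := BW ((set_val x)^-1 * g); rewrite mulgK; apply.
have Lx : Lambda G (set_val x)^-1.
  by apply: HL; have := set_valP (x^-1).
have xg : (fun y : H => (set_val x)^-1 * set_val y) @ p --> (set_val x)^-1 * g.
  exact: (cvg_comp _ _ pg (Lx g)).
apply: (closed_cvg (closure B) (@closed_closure _ _) _ _ xg).
by apply: filterS xB => y /= /interior_subset/subset_closure.
Qed.

(** An ultrafilter test for the continuity at [g] of a map defined only on [H]: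
    take for [S] the preimage of a neighbourhood of the expected limit. *)
Lemma cvg_ultrafilter_avoiding (X : topologicalType) (H : set X) (g : X)
    (S : set H) :
  ~ (exists2 V, nbhs g V & set_val @^-1` V `<=` S) ->
  exists2 p : set_system H,
    UltraFilter p & p (~` S) /\ (set_val : H -> X) @ p --> g.
Proof.
move=> noV.
pose F : set_system H := [set A | exists2 V, nbhs g V & set_val @^-1` V `\` S `<=` A].
have FP : ProperFilter F.
  apply: Build_ProperFilter_ex.
    move=> A [V nV VA]; apply: contrapT => A0; apply: noV; exists V => // x Vx.
    by apply: contrapT => Sx; apply: A0; exists x; apply: VA.
  split.
  - by exists setT => //; exact: filterT.
  - move=> A B [V nV VA] [W nW WB]; exists (V `&` W); first exact: filterI.
    by move=> x [[Vx Wx] Sx]; split; [exact: VA|exact: WB].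
  - by move=> A B AB [V nV VA]; exists V => // x /VA/AB.
have [p [pU Fp]] := ultraFilterLemma FP; exists p => //; split.
  by apply: Fp; exists setT; [exact: filterT|move=> x []].
by move=> V nV; apply: Fp; exists V => // x [].
Qed.

(** Inversion extends continuously from [H] at every point, and its extension
    at [g] is inversion; in a regular space such an extension is continuous
    (Bourbaki's extension by continuity). *)
Lemma schur_cvg_continuous_invg (G : groupTopologicalType) (H : subgroup G) :
  regular_space G -> right_topological G ->
  dense H -> H `<=` Lambda G ->
  (forall u : set_system H, UltraFilter u -> schur u -> subgroup_cvg1 u) ->
  continuous (fun x : G => x^-1).
Proof.
move=> regG rG dH HL schur1.
have invH g W : nbhs g^-1 W ->
    exists2 V, nbhs g V & set_val @^-1` V `<=` [set h : H | W (set_val h)^-1].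
  move=> nW; apply: contrapT => /cvg_ultrafilter_avoiding[p pU [pnW pg]].
  have pP : ProperFilter p by exact: ultra_proper.
  have p1 : subgroup_cvg1 (ratio_filter p).
    by apply: schur1; [exact: ratio_filter_ultra|exact: ratio_filter_schur].
  have pW := ratio_cvg_invg regG rG HL pP p1 pg nW.
  by have [? []] := @filter_ex _ p _ _ (@filterI _ p _ _ _ pnW pW).
move=> g W nW /=; have [B nB BW] := regG _ _ nW.
have [V nV VB] := invH g B nB.
suff : V° `<=` [set x | W x^-1].
  by move=> VW; apply: filterS VW _; exact: nbhs_interior.
(* [x^-1] is adherent to [B]: near both [g] and [x] there is [h] in [H], whose
   inverse is in [B] and in any given neighbourhood of [x^-1]. *)
move=> x Vx; apply: BW => C nC; have [V' nV' V'C] := invH x C nC.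
have [y [[Vy V'y] Hy]] : (V° `&` V'°) `&` H !=set0.
  apply: dH; last by apply: openI; exact: open_interior.
  by exists x; split.
have [h hy] : exists h : H, set_val h = y.
  by exists (SigSub (mem_set Hy)).
exists y^-1; rewrite -hy; split.
- by apply: VB; rewrite /= hy; exact: interior_subset.
- by apply: V'C; rewrite /= hy; exact: interior_subset.
Qed.

(** * Chart groups *)

(** On a compact Hausdorff space a continuous left shift is a closed map, so its
    inverse, the left shift by the inverse element, is continuous. *)
Lemma Lambda_group_closed (G : groupTopologicalType) :
  compact [set: G] -> hausdorff_space G -> group_closed (mem (Lambda G)).
Proof.
move=> cG hG.
have LV (s : G) : Lambda G s -> Lambda G s^-1.
  move=> Ls; apply/continuous_closedP => C cC.
  have -> : (fun x => s^-1 * x) @^-1` C = (fun x => s * x) @` C.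
    apply/seteqP; split => [x Cx|_ [x Cx <-]] /=; last by rewrite mulKg.
    by exists (s^-1 * x) => //; rewrite mulVKg.
  apply: (compact_closed hG); apply: continuous_compact.
    exact: continuous_subspaceT.
  exact: (subclosed_compact cC cG).
split.
  apply/mem_set; rewrite /Lambda /=.
  by under eq_fun do rewrite mul1g; move=> x; exact: cvg_id.
move=> s t /set_mem Ls /set_mem /LV Lt; apply/mem_set; rewrite /Lambda /=.
under eq_fun do rewrite -mulgA.
by move=> x; exact: (cvg_comp _ _ (Lt x) (Ls _)).
Qed.

(** If the limit [p] were different from [p * p], a small enough neighbourhood
    of [p], which belongs to the ultrafilter, would be disjoint from the set of
    products of its elements. *)
Lemma schur_cvg1 (G : groupTopologicalType) (u : set_system G) :
  compact [set: G] -> hausdorff_space G ->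
  continuous (fun p : G * G => p.1 * p.2) -> UltraFilter u -> schur u ->
  u --> (1 : G).
Proof.
move=> cG hG mG uU uS; have uP : ProperFilter u by exact: ultra_proper.
have [p up] := compact_ultra_cvg id uU cG.
suff -> : (1 : G) = p by [].
have pp : p * p = p.
  apply: contrapT => /eqP; move: hG; rewrite open_hausdorff => h /h.
  move=> [[A B] /= [/set_mem App /set_mem Bp] [oA oB /eqP AB0]].
  have [[V V'] /= [nV nV'] VVA] := mG (p, p) A (open_nbhs_nbhs (conj oA App)).
  have uW : u (V `&` V' `&` B).
    apply: (up (V `&` V' `&` B)); apply: filterI; first exact: filterI.
    exact: open_nbhs_nbhs.
  have [x [y [[[Vx _] _] [[_ V'y] _] [_ Bxy]]]] := uS _ uW.
  suff : (A `&` B) (x * y) by rewrite AB0.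
  by split => //; exact: (VVA (x, y) (conj Vx V'y)).
by apply: (mulgI p); rewrite mulg1.
Qed.

Theorem theorem2p10 (G : groupTopologicalType) (hG : chart_group G) :
  [<-> topological_group G;
       forall u : set_system G, UltraFilter u -> schur u -> u --> (1 : G);
       exists H : subgroup G,
         [/\ dense H, H `<=` Lambda G
           & forall u : set_system H, UltraFilter u -> schur u ->
               subgroup_cvg1 u]].
Proof.
have [cG hausG rG dL] := hG.
have regG : regular_space G by move=> x; exact: (compact_regular hausG cG filterT).
split.
  by move=> [mG _] u; exact: schur_cvg1.
split.
  move=> schur1; exists (Subgroup (Lambda_group_closed cG hausG)); split => //.
  move=> u uU uS V oV V1.
  apply: (schur1 (set_val @ u)); last exact: open_nbhs_nbhs.
    exact: ultra_fmap.
  move=> U uUu; have [x [y [Ux Uy Uxy]]] := uS _ uUu.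
  by exists (set_val x), (set_val y); split.
move=> [H [dH HL schur1]].
have cV := schur_cvg_continuous_invg regG rG dH HL schur1.
split=> //; apply: separately_continuous_mulg => // s x.
have -> : (fun x => s * x) = (fun x => (x^-1 * s^-1)^-1).
  by apply/funext => y; rewrite invgM !invgK.
exact: (cvg_comp _ _ (cvg_comp _ _ (cV x) (rG s^-1 x^-1)) (cV _)).
Qed.
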